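(* Let $R=\bigoplus_{\alpha\in\Gamma}R_{\alpha}$ be a graded integral domain and let $\star$ be a semistar operation on $R$ such that $R^{\star}\subsetneq R_H$. Then $R$ is a GP$\star$MD if and only if $(A_fA_g)^{\widetilde{\star}}=A_{fg}^{\widetilde{\star}}$ for all $f,g\in R_H[X]$.
   Context: $\Gamma$ is a commutative cancellative monoid (written additively) whose quotient group $\langle\Gamma\rangle$ is torsion-free. A graded integral domain $R=\bigoplus_{\alpha\in\Gamma}R_\alpha$ is an integral domain that is the direct sum of additive subgroups $R_\alpha$ with $R_\alpha R_\beta\subseteq R_{\alpha+\beta}$. $K$ is its quotient field, $H$ the set of nonzero homogeneous elements, $R_H$ (graded by $\langle\Gamma\rangle$) the homogeneous quotient field. For $a\in R_H$, $C(a)$ is the $R$-submodule of $R_H$ generated by the homogeneous components of $a$; for $f=f_0+\cdots+f_nX^n\in R_H[X]$, $A_f:=\sum_i C(f_i)$. A semistar operation on $R$ is a map $\star$ from the set of nonzero $R$-submodules of $K$ to itself such that for all $0\ne x\in K$ and $E,F$: $(xE)^\star=xE^\star$; $E\subseteq F\Rightarrow E^\star\subseteq F^\star$; $E\subseteq E^\star$; $(E^\star)^\star=E^\star$. $\star_f$: $E^{\star_f}=\bigcup\{F^\star: F\subseteq E$ nonzero finitely generated fractional ideal$\}$. $\widetilde\star$: $E^{\widetilde\star}=\{x\in K: xJ\subseteq E$ for some finitely generated ideal $J\subseteq R$ with $J^\star=R^\star\}$. A nonzero fractional ideal $I$ is $\star_f$-invertible if $(I(R:I))^{\star_f}=R^\star$.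 $R$ is a GP$\star$MD if every nonzero finitely generated homogeneous ideal of $R$ is $\star_f$-invertible. *)

(* Defs.v *)
From HB Require Import structures.
From mathcomp Require Import all_boot all_order all_algebra.
From mathcomp Require Import boolp classical_sets.
Set Implicit Arguments. Unset Strict Implicit. Unset Printing Implicit Defensive.
Import Order.TTheory GRing.Theory.
Local Open Scope ring_scope.
Local Open Scope classical_set_scope.

(* Gamma is a submonoid of the abelian group G, G is generated by Gamma
   (so G is the quotient group <Gamma>), and G is torsion-free. *)
Definition grading_monoid (G : zmodType) (Gam : set G) : Prop :=
  [/\ Gam 0,
      (forall a b, Gam a -> Gam b -> Gam (a + b)),
      (forall g : G, exists a b, [/\ Gam a, Gam b & g = a - b]) &
      (forall (n : nat) (g : G), (0 < n)%N -> g *+ n = 0 -> g = 0)].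

Definition subring (K : fieldType) (R : set K) : Prop :=
  [/\ R 0, R 1, (forall a b, R a -> R b -> R (a - b)) &
      (forall a b, R a -> R b -> R (a * b))].

Definition is_quotient_field (K : fieldType) (R : set K) : Prop :=
  forall x : K, exists a b, [/\ R a, R b, b != 0 & x = a / b].

Definition graded_domain (G : zmodType) (Gam : set G) (K : fieldType)
    (R : set K) (Rg : G -> set K) : Prop :=
  [/\ subring R /\ is_quotient_field R,
      (forall al, Rg al `<=` R) /\ (forall al, ~ Gam al -> Rg al = [set 0]),
      (forall al, Rg al 0 /\ forall a b, Rg al a -> Rg al b -> Rg al (a - b)) /\
      (forall al be a b, Rg al a -> Rg be b -> Rg (al + be) (a * b)),
      (forall r, R r -> exists s : seq (G * K),
          (forall p, p \in s -> Rg p.1 p.2) /\ r = \sum_(p <- s) p.2) &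
      (forall s : seq (G * K), uniq (map fst s) ->
          (forall p, p \in s -> Rg p.1 p.2) -> \sum_(p <- s) p.2 = 0 ->
          forall p, p \in s -> p.2 = 0)].

Definition Hom (G : zmodType) (K : fieldType) (Rg : G -> set K) : set K :=
  [set h | h != 0 /\ exists al, Rg al h].

Definition RH (G : zmodType) (K : fieldType) (R : set K) (Rg : G -> set K) : set K :=
  [set x | exists a h, [/\ R a, Hom Rg h & x = a / h]].

Definition RHg (G : zmodType) (K : fieldType) (Rg : G -> set K) (be : G) : set K :=
  [set x | exists al ga a h,
     [/\ Rg al a, Rg ga h, h != 0, be = al - ga & x = a / h]].

Definition hcomponents (G : zmodType) (K : fieldType) (Rg : G -> set K) (x : K)
  : set K :=
  [set y | exists s : seq (G * K),
     [/\ uniq (map fst s), (forall p, p \in s -> RHg Rg p.1 p.2),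
         x = \sum_(p <- s) p.2 & y \in map snd s]].

Definition Rspan (K : fieldType) (R : set K) (S : set K) : set K :=
  [set x | exists s : seq (K * K),
     (forall p, p \in s -> R p.1 /\ S p.2) /\ x = \sum_(p <- s) p.1 * p.2].

Definition msum (K : fieldType) (E F : set K) : set K :=
  [set x | exists e f, [/\ E e, F f & x = e + f]].

Definition mprod (K : fieldType) (E F : set K) : set K :=
  [set x | exists s : seq (K * K),
     (forall p, p \in s -> E p.1 /\ F p.2) /\ x = \sum_(p <- s) p.1 * p.2].

Definition mscale (K : fieldType) (x : K) (E : set K) : set K := [set x * e | e in E].

Definition colon (K : fieldType) (R I : set K) : set K :=
  [set x | forall i, I i -> R (x * i)].

Definition nzmod (K : fieldType) (R : set K) (E : set K) : Prop :=
  [/\ E 0, (forall a b, E a -> E b -> E (a + b)),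
      (forall r e, R r -> E e -> E (r * e)) & exists x, E x /\ x != 0].

Definition fin_gen (K : fieldType) (R : set K) (E : set K) : Prop :=
  exists s : seq K, E = Rspan R [set x | x \in s].

Definition frac_ideal (K : fieldType) (R : set K) (E : set K) : Prop :=
  nzmod R E /\ exists d, [/\ R d, d != 0 & forall e, E e -> R (d * e)].

Definition Cont (G : zmodType) (K : fieldType) (R : set K) (Rg : G -> set K)
  (a : K) : set K := Rspan R (hcomponents Rg a).

Definition Af (G : zmodType) (K : fieldType) (R : set K) (Rg : G -> set K)
  (f : {poly K}) : set K :=
  \big[@msum K/[set 0]]_(i < size f) Cont R Rg f`_i.

Definition semistar (K : fieldType) (R : set K) (star : set K -> set K) : Prop :=
  [/\ (forall E, nzmod R E -> nzmod R (star E)),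
      (forall x E, x != 0 -> nzmod R E -> star (mscale x E) = mscale x (star E)),
      (forall E F, nzmod R E -> nzmod R F -> E `<=` F -> star E `<=` star F),
      (forall E, nzmod R E -> E `<=` star E) &
      (forall E, nzmod R E -> star (star E) = star E)].

Definition star_f (K : fieldType) (R : set K) (star : set K -> set K) (E : set K)
  : set K :=
  [set x | exists F, [/\ F `<=` E, frac_ideal R F, fin_gen R F & star F x]].

Definition star_tilde (K : fieldType) (R : set K) (star : set K -> set K)
  (E : set K) : set K :=
  [set x | exists J, [/\ J `<=` R, nzmod R J, fin_gen R J, star J = star R &
                        forall j, J j -> E (x * j)]].

Definition starf_invertible (K : fieldType) (R : set K) (star : set K -> set K)
  (I : set K) : Prop :=
  star_f R star (mprod I (colon R I)) = star R.

Definition hom_ideal (G : zmodType) (K : fieldType) (R : set K) (Rg : G -> set K)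
  (I : set K) : Prop :=
  [/\ I `<=` R, nzmod R I & I = Rspan R [set x | I x /\ exists al, Rg al x]].

Definition GPstarMD (G : zmodType) (K : fieldType) (R : set K) (Rg : G -> set K)
  (star : set K -> set K) : Prop :=
  forall I, hom_ideal R Rg I -> fin_gen R I -> starf_invertible R star I.

(* Main.v *)
Require Import Defs.
From HB Require Import structures.
From mathcomp Require Import all_boot all_order all_algebra.
From mathcomp Require Import boolp classical_sets.
From mathcomp Require Import ring.
Set Implicit Arguments. Unset Strict Implicit. Unset Printing Implicit Defensive.
Import GRing.Theory.
Local Open Scope ring_scope.
Local Open Scope classical_set_scope.

(** Both directions use that [star_tilde] is the closure operation of a localizing
    system: the finitely generated ideals [J] with [J^star = R^star], which are closed
    under products.

    Grading [R_H[X]] by [nat * G] makes [A_f] the content of [f]. If [f = p + f'] and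
    [g = q + g'] with leading terms [p], [q] for an order on the degrees, induction on
    the number of terms puts [A_f A_g] in both [(A_fg + p A_g)~] and [(A_fg + q A_f)~].
    As [p q] is in [A_fg], it follows that [A_f A_f A_g] lies in [(A_f A_fg)~], and the
    [star_f]-invertible module [A_f] can be cancelled.

    Conversely, for homogeneous [a], [b] the content formula for [a + b X] and
    [a - b X] gives [a b j = r a^2 + s b^2] for all [j] in some [J] of the system. With
    [v = s b / a], the polynomial [(X - v) (X - (j - v))] has coefficients in [R], so the
    formula puts [v] in [R~]; and [j = b (s / a) + a (r / b)] then shows that [(a, b)]
    is invertible. Invertibility of all pairs passes to finitely many generators. *)

(** * Submodules of a field over a subring: spans, products and sums *)

Section Submodules.
Variables (K : fieldType) (R : set K).
Hypothesis hR : subring R.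

(** Unlike [nzmod], this admits the zero module, which is the content of the zero polynomial. *)
Definition submod (M : set K) : Prop :=
  [/\ M 0, (forall a b, M a -> M b -> M (a + b)) &
      forall r a, R r -> M a -> M (r * a)].

Lemma subring0 : R 0. Proof. by case: hR. Qed.

Lemma subring1 : R 1. Proof. by case: hR. Qed.

Lemma subringB a b : R a -> R b -> R (a - b).
Proof. by case: hR => _ _ h _; exact: h. Qed.

Lemma subringM a b : R a -> R b -> R (a * b).
Proof. by case: hR => _ _ _; exact. Qed.

Lemma subringN a : R a -> R (- a).
Proof. by rewrite -sub0r; apply: subringB; exact: subring0. Qed.

Lemma subringD a b : R a -> R b -> R (a + b).
Proof. by move=> ra rb; rewrite -[b]opprK; apply: subringB => //; exact: subringN. Qed.

Lemma submod_self : submod R.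
Proof. split; [exact: subring0 | exact: subringD | exact: subringM]. Qed.

Lemma submod0 M : submod M -> M 0. Proof. by case. Qed.

Lemma submodD M a b : submod M -> M a -> M b -> M (a + b).
Proof. by case=> _ h _; exact: h. Qed.

Lemma submodZ M r a : submod M -> R r -> M a -> M (r * a).
Proof. by case=> _ _; exact. Qed.

Lemma submodN M a : submod M -> M a -> M (- a).
Proof.
by move=> sM Ma; rewrite -mulN1r; apply: submodZ => //; exact/subringN/subring1.
Qed.

Lemma submod_sum (I : eqType) (s : seq I) (P : pred I) (F : I -> K) M :
  submod M -> (forall i, i \in s -> P i -> M (F i)) -> M (\sum_(i <- s | P i) F i).
Proof.
move=> sM h; rewrite big_seq_cond; apply: big_ind.
- exact: submod0.
- by move=> *; apply: submodD.
- by move=> i /andP[]; exact: h.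
Qed.

(** With [Rspan_sub] or [mprod_sub], this reduces [M (x * y)] for [y] in a span or a product to the
    case of a generator [y]. *)
Lemma submod_scale M (x : K) : submod M -> submod [set y | M (x * y)].
Proof.
move=> sM; split => /= [|a b Ma Mb|r a Rr Ma]; first by rewrite mulr0; exact: submod0.
  by rewrite mulrDr; exact: submodD.
by rewrite mulrCA; exact: submodZ.
Qed.

Lemma Rspan_submod S : submod (Rspan R S).
Proof.
split.
- by exists [::]; rewrite big_nil.
- move=> _ _ [s [hs ->]] [t [ht ->]]; exists (s ++ t); rewrite big_cat; split=> // p.
  by rewrite mem_cat => /orP[/hs|/ht].
- move=> r _ Rr [s [hs ->]]; exists [seq (r * p.1, p.2) | p <- s]; split.
    by move=> _ /mapP[p /hs[Rp Sp] ->]; split => //; exact: subringM.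
  by rewrite big_map mulr_sumr; apply: eq_bigr => p _; rewrite mulrA.
Qed.

Lemma sub_Rspan S x : S x -> Rspan R S x.
Proof.
move=> Sx; exists [:: (1, x)]; rewrite big_seq1 mul1r; split=> // p.
by rewrite inE => /eqP -> /=; split=> //; exact: subring1.
Qed.

Lemma Rspan_sub S M : submod M -> (forall x, S x -> M x) -> Rspan R S `<=` M.
Proof.
move=> sM h _ [s [hs ->]]; apply: submod_sum => // p /hs[Rp /h Mp] _.
exact: submodZ.
Qed.

Lemma mprod_submod E F : submod E -> submod (mprod E F).
Proof.
move=> sE; split.
- by exists [::]; rewrite big_nil.
- move=> _ _ [s [hs ->]] [t [ht ->]]; exists (s ++ t); rewrite big_cat; split=> // p.
  by rewrite mem_cat => /orP[/hs|/ht].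
- move=> r _ Rr [s [hs ->]]; exists [seq (r * p.1, p.2) | p <- s]; split.
    by move=> _ /mapP[p /hs[Rp Sp] ->]; split => //; exact: submodZ.
  by rewrite big_map mulr_sumr; apply: eq_bigr => p _; rewrite mulrA.
Qed.

Lemma mem_mprod (E F : set K) x y : E x -> F y -> mprod E F (x * y).
Proof.
by move=> Ex Fy; exists [:: (x, y)]; rewrite big_seq1; split=> // p; rewrite inE => /eqP->.
Qed.

Lemma mprod_sub (E F M : set K) :
  submod M -> (forall x y, E x -> F y -> M (x * y)) -> mprod E F `<=` M.
Proof.
move=> sM h _ [s [hs ->]]; apply: submod_sum => // p /hs[Ep Fp] _; exact: h.
Qed.

Lemma msum_submod E F : submod E -> submod F -> submod (msum E F).
Proof.
move=> sE sF; split.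
- by exists 0, 0; rewrite addr0; split=> //; exact: submod0.
- move=> _ _ [a [b [Ea Fb ->]]] [c [d [Ec Fd ->]]]; exists (a + c), (b + d).
  by rewrite addrACA; split=> //; exact: submodD.
- move=> r _ Rr [a [b [Ea Fb ->]]]; exists (r * a), (r * b).
  by rewrite mulrDr; split=> //; exact: submodZ.
Qed.

Lemma mscale_submod x E : submod E -> submod (mscale x E).
Proof.
move=> [E0 ED EZ]; split.
- by exists 0; rewrite ?mulr0.
- by move=> _ _ [a Ea <-] [b Eb <-]; exists (a + b); [exact: ED|rewrite mulrDr].
- by move=> r _ Rr [a Ea <-]; exists (r * a); [exact: EZ|rewrite mulrCA].
Qed.

Lemma big_msum_submod n (E : nat -> set K) :
  (forall i, submod (E i)) -> submod (\big[@msum K/[set 0]]_(i < n) E i).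
Proof.
move=> sE; apply: big_ind => //; last exact: msum_submod.
split=> //= [a b -> ->|r a _ ->]; [by rewrite addr0|by rewrite mulr0].
Qed.

Lemma big_msum_sup n (E : nat -> set K) i : (forall i, submod (E i)) ->
  (i < n)%N -> E i `<=` \big[@msum K/[set 0]]_(i < n) E i.
Proof.
elim: n E i => // n IH E [|i] sE lin x Ex; rewrite big_ord_recl.
  exists x, 0; rewrite addr0; split=> //; apply: submod0.
  exact: (@big_msum_submod _ (fun i => E i.+1)).
exists 0, x; rewrite add0r; split=> //; first by apply: submod0; exact: sE.
exact: (IH (fun i => E i.+1) i).
Qed.

Lemma nzmod_submod M : nzmod R M -> submod M. Proof. by case. Qed.

Lemma submod_nzmod M x : submod M -> M x -> x != 0 -> nzmod R M.
Proof. by case=> M0 MD MZ Mx x0; split=> //; exists x. Qed.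

Lemma nzmod_self : nzmod R R.
Proof. exact: submod_nzmod submod_self subring1 (oner_neq0 K). Qed.

Lemma mprod_colon_sub I : mprod I (colon R I) `<=` R.
Proof.
apply: mprod_sub; first exact: submod_self.
by move=> x y Ix hy; rewrite mulrC; exact: hy.
Qed.

Lemma fin_gen_mprod E F : fin_gen R E -> fin_gen R F -> fin_gen R (mprod E F).
Proof.
move=> [s ->] [t ->]; exists [seq x * y | x <- s, y <- t]; apply/seteqP; split.
  apply: mprod_sub; first exact: Rspan_submod.
  move=> x y hx hy; move: x hx.
  (* Bilinearity in two passes: first [x] is reduced to a generator with [y] fixed, then [y] with
     that generator fixed. *)
  have sS := Rspan_submod [set x | x \in [seq x * y | x <- s, y <- t]].
  have sM := submod_scale y sS.
  move=> x hx; rewrite mulrC; apply: (Rspan_sub sM _ hx) => /= {x hx}x xs.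
  rewrite mulrC; apply: (Rspan_sub (submod_scale x sS) _ hy) => /= {y hy sM}y yt.
  by apply: sub_Rspan => /=; apply/allpairsP; exists (x, y).
apply: Rspan_sub; first exact/mprod_submod/Rspan_submod.
by move=> _ /allpairsP[[x y] /= [xs yt ->]]; apply: mem_mprod; exact: sub_Rspan.
Qed.

Lemma fin_gen_self : fin_gen R R.
Proof.
exists [:: 1]; apply/seteqP; split.
  move=> r Rr; rewrite -[r]mulr1; apply: submodZ; [exact: Rspan_submod|by []|].
  by apply: sub_Rspan => /=; rewrite inE.
apply: Rspan_sub; first exact: submod_self.
by move=> x /=; rewrite inE => /eqP ->; exact: subring1.
Qed.

(** * The closure operation [star_tilde] and invertibility *)

Section StarTilde.
Variable star : set K -> set K.
Hypothesis hstar : semistar R star.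

Local Notation w := (star_tilde R star).

Definition dense_ideal (J : set K) : Prop :=
  [/\ J `<=` R, nzmod R J, fin_gen R J & star J = star R].

Lemma star_tildeP E x :
  w E x <-> exists2 J, dense_ideal J & forall j, J j -> E (x * j).
Proof.
split=> [[J [h1 h2 h3 h4 h5]]|[J [h1 h2 h3 h4] h5]]; first by exists J.
by exists J.
Qed.

Lemma star_submod E : nzmod R E -> submod (star E).
Proof. by case: hstar => h _ _ _ _ /h /nzmod_submod. Qed.

Lemma star_eq_self J : nzmod R J -> J `<=` R -> star J 1 -> star J = star R.
Proof.
move=> nJ JR J1; case: hstar => hn _ hm _ hi; apply/seteqP; split.
  by apply: hm => //; exact: nzmod_self.
rewrite -(hi _ nJ); apply: hm; [exact: nzmod_self|exact: hn|].
move=> r Rr; rewrite -[r]mulr1; apply: submodZ => //; exact: star_submod.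
Qed.

Lemma dense_ideal_self : dense_ideal R.
Proof. by split=> //; [exact: nzmod_self | exact: fin_gen_self]. Qed.

(** For nonzero [x] in [I], [x] lies in [x R^star = x J^star = (x J)^star], hence in [(I J)^star].
    So [I] lies in [(I J)^star], and then so does [I^star = R^star]. *)
Lemma dense_ideal_mprod I J :
  dense_ideal I -> dense_ideal J -> dense_ideal (mprod I J).
Proof.
move=> [IR nI fI sI] [JR nJ fJ sJ].
have sbI := nzmod_submod nI; have sbJ := nzmod_submod nJ.
have sR : mprod I J `<=` R.
  apply: mprod_sub; first exact: submod_self.
  by move=> x y Ix Jy; apply: subringM; [exact: IR|exact: JR].
have nIJ : nzmod R (mprod I J).
  case: (nI) => _ _ _ [x [Ix x0]]; case: (nJ) => _ _ _ [y [Jy y0]].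
  apply: (@submod_nzmod _ (x * y)); [exact: mprod_submod|exact: mem_mprod|].
  by rewrite mulf_neq0.
split=> //; first exact: fin_gen_mprod.
apply: star_eq_self => //; case: (hstar) => hn hx hm he hi.
have R1 : star R 1 by apply: he; [exact: nzmod_self|exact: subring1].
have IIJ : I `<=` star (mprod I J).
  move=> x Ix; have [->|x0] := eqVneq x 0; first by apply: submod0; exact: star_submod.
  have nxJ : nzmod R (mscale x J).
    case: (nJ) => J0 JD JZ [y [Jy y0]]; split.
    - by exists 0 => //; rewrite mulr0.
    - by move=> _ _ [a Ja <-] [b Jb <-]; exists (a + b); [exact: JD|rewrite mulrDr].
    - by move=> r _ Rr [a Ja <-]; exists (r * a); [exact: JZ|rewrite mulrCA].
    - by exists (x * y); split; [exists y|rewrite mulf_neq0].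
  have : star (mscale x J) x by rewrite hx // sJ; exists 1 => //; rewrite mulr1.
  by apply: (hm _ _ nxJ nIJ) => _ [j Jj <-]; exact: mem_mprod.
have := hm _ _ nI (hn _ nIJ) IIJ; rewrite sI hi //; exact.
Qed.

Lemma star_tilde_mono E F : E `<=` F -> w E `<=` w F.
Proof. by move=> EF x /star_tildeP[J dJ h]; apply/star_tildeP; exists J => // j /h /EF. Qed.

Lemma star_tilde_ext E : submod E -> E `<=` w E.
Proof.
move=> sE x Ex; apply/star_tildeP; exists R; first exact: dense_ideal_self.
by move=> j Rj; rewrite mulrC; exact: submodZ.
Qed.

Lemma star_tilde_submod E : submod E -> submod (w E).
Proof.
move=> sE; split.
- by apply: star_tilde_ext => //; exact: submod0.
- move=> a b /star_tildeP[I dI hI] /star_tildeP[J dJ hJ]; apply/star_tildeP.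
  exists (mprod I J); first exact: dense_ideal_mprod.
  move=> j; apply: (mprod_sub (submod_scale (a + b) sE)) => x y Ix Jy /=.
  rewrite mulrDl; apply: submodD => //.
    rewrite mulrA mulrC; apply: submodZ => //; last exact: hI.
    by case: dJ => JR _ _ _; exact: JR.
  rewrite mulrCA; apply: submodZ => //; last exact: hJ.
  by case: dI => JR _ _ _; exact: JR.
- move=> r a Rr /star_tildeP[J dJ hJ]; apply/star_tildeP; exists J => // j Jj.
  by rewrite -mulrA; apply: submodZ => //; exact: hJ.
Qed.

(** Finite generation of [J] is essential: each generator [j] has its own ideal carrying [x j] into
    [E], and the product [I] of these finitely many ideals serves them all, so that [x J I] lies in
    [E]. *)
Lemma star_tilde_idem E : submod E -> w (w E) `<=` w E.
Proof.
move=> sE x /star_tildeP[J dJ hJ]; case: (dJ) => _ _ [l eJ] _.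
have [I dI hI] : exists2 I, dense_ideal I &
    forall j, j \in l -> forall i, I i -> E (x * j * i).
  have : forall j, j \in l -> w E (x * j).
    by move=> j jl; apply: hJ; rewrite eJ; exact: sub_Rspan.
  elim: l {hJ dJ eJ} => [|j l IH] h; first by exists R; first exact: dense_ideal_self.
  have [|I dI hI] := IH; first by move=> k kl; apply: h; rewrite inE kl orbT.
  have /star_tildeP[I' dI' hI'] := h j (mem_head _ _).
  exists (mprod I I'); first exact: dense_ideal_mprod.
  move=> k kjl i; apply: (mprod_sub (submod_scale (x * k) sE)) => a b Ia Ib /=.
  move: kjl; rewrite inE => /orP[/eqP ->|kl].
    by rewrite mulrCA; apply: submodZ => //; [case: dI => IR _ _ _; exact: IR|exact: hI'].
  rewrite mulrA mulrC; apply: submodZ => //; [case: dI' => IR _ _ _; exact: IR|exact: hI].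
apply/star_tildeP; exists (mprod J I); first exact: dense_ideal_mprod.
move=> k; apply: (mprod_sub (submod_scale x sE)) => a b Ja Ib /=.
rewrite [a * b]mulrC mulrA; move: Ja; rewrite eJ.
apply: (Rspan_sub (submod_scale (x * b) sE)) => j jl /=.
by rewrite mulrAC; exact: hI.
Qed.

(** The form in which idempotence is mostly applied: an element of [w E] may be replaced by an
    element of [E] when the goal is a closure. *)
Lemma star_tilde_scale E F x y :
  submod F -> (forall e, E e -> w F (x * e)) -> w E y -> w F (x * y).
Proof.
move=> sF h /star_tildeP[J dJ hJ]; apply: star_tilde_idem => //.
by apply/star_tildeP; exists J => // j /hJ Ej; rewrite -mulrA; exact: h.
Qed.

(** Since [I (R : I)] lies in [R], a finitely generated [F] inside it with [1] in [F^star] is itself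
    an ideal of the localizing system. Conversely, an ideal of the system inside [I (R : I)] has
    closure [R^star]. *)
Lemma starf_invertibleP I : submod I ->
  starf_invertible R star I <-> w (mprod I (colon R I)) 1.
Proof.
move=> sI; have sT : submod (mprod I (colon R I)) by exact: mprod_submod.
have TR := @mprod_colon_sub I.
case: (hstar) => hn _ hm he _; split.
  move=> inv; have : star_f R star (mprod I (colon R I)) 1.
    by rewrite inv; apply: he; [exact: nzmod_self|exact: subring1].
  move=> [F [FT [nF _] fF F1]].
  have FR : F `<=` R by move=> x /FT /TR.
  apply/star_tildeP; exists F; last by move=> j /FT; rewrite mul1r.
  by split=> //; exact: star_eq_self.
move=> /star_tildeP[J [JR nJ fJ sJ] hJ]; apply/seteqP; split.
  move=> x [F [FT [nF _] fF]]; apply: hm => //; first exact: nzmod_self.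
  by move=> y /FT /TR.
move=> x Rx; exists J; split=> //; last by rewrite sJ.
- by move=> j /hJ; rewrite mul1r.
- split=> //; exists 1; split; [exact: subring1|exact: oner_neq0|].
  by move=> e /JR; rewrite mul1r.
Qed.

(** Write [x = x 1] with [1] in the closure of [I (R : I)]. Then [x I (R : I)] lies in
    [(R : I) w (I X)], hence in [w X]. *)
Lemma star_tilde_cancel I X x : submod X ->
  w (mprod I (colon R I)) 1 -> (forall i, I i -> w (mprod I X) (i * x)) -> w X x.
Proof.
move=> sX inv h; rewrite -[x]mulr1; apply: (star_tilde_scale sX _ inv) => y.
apply: (mprod_sub (submod_scale x (star_tilde_submod sX))) => a b Ia hb /=.
have -> : x * (a * b) = b * (a * x) by ring.
apply: (star_tilde_scale sX _ (h a Ia)) => e.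
apply: (mprod_sub (submod_scale b (star_tilde_submod sX))) => c d Ic Xd /=.
by rewrite mulrA; apply: star_tilde_ext => //; apply: submodZ => //; exact: hb.
Qed.

End StarTilde.
End Submodules.

(** * Partial orders on a torsion-free abelian group *)

Section Cones.
Variable G : zmodType.
Hypothesis tfG : forall (n : nat) (g : G), (0 < n)%N -> g *+ n = 0 -> g = 0.

(** The set of nonnegative elements of a translation-invariant partial order on [G]. *)
Definition cone (P : set G) : Prop :=
  [/\ P 0, (forall x y, P x -> P y -> P (x + y)) & forall x, P x -> P (- x) -> x = 0].

Lemma cone_mulrn P x n : cone P -> P x -> P (x *+ n).
Proof.
by move=> [P0 PD _] Px; elim: n => [|n IH] //; rewrite mulrS; exact: PD.
Qed.

(** The new cone consists of the [p + n g]. If it contains [x] and [- x], the sum of the two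
    expressions puts [- (n + m) g] in [P], which forces [n = m = 0] and leaves [x] and [- x] in
    [P]. *)
Lemma cone_adjoin P g :
  cone P -> (forall n, (0 < n)%N -> ~ P (- (g *+ n))) ->
  exists Q, [/\ cone Q, P `<=` Q & Q g].
Proof.
move=> [P0 PD PN] hg; exists [set x | exists p n, P p /\ x = p + g *+ n]; split.
- split.
  + by exists 0, 0%N; rewrite add0r.
  + move=> _ _ [p [n [Pp ->]]] [q [m [Pq ->]]]; exists (p + q), (n + m)%N.
    by split; [exact: PD|rewrite mulrnDr addrACA].
  + move=> x [p [n [Pp ex]]] [q [m [Pq eNx]]].
    have e0 : p + q + g *+ (n + m) = 0 by rewrite mulrnDr addrACA -ex -eNx subrr.
    case: (posnP (n + m)%N) => [/eqP|/hg[]].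
      rewrite addn_eq0 => /andP[/eqP n0 /eqP m0].
      by apply: PN; [rewrite ex n0 addr0|rewrite eNx m0 addr0].
    by move/eqP: e0; rewrite addr_eq0 => /eqP <-; exact: PD.
- by move=> p Pp; exists p, 0%N; rewrite addr0.
- by exists 0, 1%N; rewrite add0r.
Qed.

(** Only finitely many differences of degrees need a sign, so adjoining them one by one suffices and
    no total order on [G] has to be built. *)
Lemma cone_total_on (l : seq G) :
  exists2 P, cone P & forall g, g \in l -> P g \/ P (- g).
Proof.
elim: l => [|g l [P cP hP]].
  exists [set 0] => //; split=> //= x y; first by move=> -> ->; rewrite addr0.
suff [Q [cQ PQ Qg]] : exists Q, [/\ cone Q, P `<=` Q & Q g \/ Q (- g)].
  exists Q => // h; rewrite inE => /orP[/eqP -> //|/hP[/PQ|/PQ]]; [by left|by right].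
have [h|] := pselect (forall n, (0 < n)%N -> ~ P (- (g *+ n))).
  by have [Q [cQ PQ Qg]] := cone_adjoin cP h; exists Q; split=> //; left.
move=> /existsNP[k /not_implyP[k0 /contrapT Pk]].
have [->|g0] := eqVneq g 0; first by exists P; split=> //; left; case: cP.
(* Here [- k g] is in [P] with [k > 0]. If [n g] were in [P] too, [n k g] and its negative would be,
   so [n k g = 0] and [g = 0] by torsion-freeness. *)
have [|Q [cQ PQ Qg]] := @cone_adjoin P (- g) cP; last by exists Q; split=> //; right.
move=> n n0; rewrite mulNrn opprK => Pn; move/eqP: g0; apply.
apply: (@tfG (n * k)); first by rewrite muln_gt0 n0.
case: (cP) => _ _; apply; first by rewrite mulrnA; exact: cone_mulrn.
by rewrite mulnC mulrnA -mulNrn; exact: cone_mulrn.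
Qed.

(* The lexicographic order on [nat * G], the grading monoid of [R_H[X]]. *)
Definition key_ge (P : set G) (k k' : nat * G) : Prop :=
  (k'.1 < k.1)%N \/ k'.1 = k.1 /\ P (k.2 - k'.2).

Lemma key_ge_refl P k : cone P -> key_ge P k k.
Proof. by case=> P0 _ _; right; rewrite subrr. Qed.

Lemma key_ge_trans P : cone P -> forall y x z,
  key_ge P x y -> key_ge P y z -> key_ge P x z.
Proof.
move=> [_ PD _] y x z [h|[e h]] [h'|[e' h']].
- by left; exact: ltn_trans h' h.
- by left; rewrite e'.
- by left; rewrite -e.
- right; split; first by rewrite e'.
  by have := PD _ _ h h'; rewrite addrA subrK.
Qed.

(** The gaps [k - k'] and [m - m'] are nonnegative and opposite, hence zero, first in [nat] and then
    in [G]. This keeps the product of two leading terms from being cancelled. *)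
Lemma key_ge_add_eq P k k' m m' : cone P -> key_ge P k k' -> key_ge P m m' ->
  (k'.1 + m'.1 = k.1 + m.1)%N -> k'.2 + m'.2 = k.2 + m.2 -> k' = k /\ m' = m.
Proof.
case: k k' m m' => [i a] [i' a'] [j b] [j' b'] [_ _ PN] /=.
rewrite /key_ge /= => h1 h2 e1 e2.
have [ei ej] : i' = i /\ j' = j.
  case: h1 h2 => [h1|[h1 _]] [h2|[h2 _]] //.
  - by have := ltn_add2r j' i' i; rewrite h1 e1 ltn_add2l ltnNge (ltnW h2).
  - by move: h1; rewrite -(ltn_add2r j') e1 h2 ltnn.
  - by move: h2; rewrite -(ltn_add2l i') e1 h1 ltnn.
case: h1 h2 => [|[_ h1]]; first by rewrite ei ltnn.
case=> [|[_ h2]]; first by rewrite ej ltnn.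
have eb : b - b' = - (a - a').
  by apply/eqP; rewrite eq_sym opprB subr_eq addrAC eq_sym subr_eq [b + a]addrC e2 addrC.
have a0 : a - a' = 0 by apply: PN => //; rewrite -eb.
have b0 : b - b' = 0 by rewrite eb a0 oppr0.
by rewrite ei ej (subr0_eq a0) (subr0_eq b0).
Qed.

End Cones.

Lemma sum_group_by (T : eqType) (V W : nmodType) (s : seq (T * V)) (F : T * V -> W) :
  \sum_(k <- undup (map fst s)) \sum_(p <- s | p.1 == k) F p = \sum_(p <- s) F p.
Proof.
rewrite (exchange_big_dep predT) //=; apply: eq_big_seq => p ps.
rewrite big_mkcond (bigD1_seq p.1) ?undup_uniq ?mem_undup ?map_f //= eqxx.
by rewrite big1 ?addr0 // => k; rewrite eq_sym => /negPf ->.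
Qed.

(** * Homogeneous components in the homogeneous quotient field *)

Section Components.
Variables (G : zmodType) (Gam : set G) (K : fieldType) (R : set K) (Rg : G -> set K).
Hypothesis hR : graded_domain Gam R Rg.

Local Notation RHg := (RHg Rg).

Lemma graded_subring : subring R. Proof. by case: hR => -[]. Qed.

Lemma Rg_sub al x : Rg al x -> R x.
Proof. by case: hR => _ [h _] _ _ _; exact: h. Qed.

Lemma Rg0 al : Rg al 0.
Proof. by case: hR => _ _ [h _] _ _; case: (h al). Qed.

Lemma RgB al x y : Rg al x -> Rg al y -> Rg al (x - y).
Proof. by case: hR => _ _ [h _] _ _; case: (h al) => _; exact. Qed.

Lemma RgD al x y : Rg al x -> Rg al y -> Rg al (x + y).
Proof.
move=> rx ry; rewrite -[y]opprK; apply: RgB => //; rewrite -sub0r.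
by apply: RgB => //; exact: Rg0.
Qed.

Lemma RgM al be x y : Rg al x -> Rg be y -> Rg (al + be) (x * y).
Proof. by case: hR => _ _ [_ h] _ _; exact: h. Qed.

Lemma exists_Hom : exists ga h, Rg ga h /\ h != 0.
Proof.
apply: contrapT => hN; have := subring1 graded_subring.
case: (hR) => _ _ _ hs _ /hs[s [ss /eqP]]; apply/negP.
rewrite big1_seq ?oner_neq0 // => p /= /ss rp.
by apply/eqP/negPn/negP => p0; apply: hN; exists p.1, p.2.
Qed.

Lemma RHg_0 be : RHg be 0.
Proof.
have [ga [h [rh h0]]] := exists_Hom; exists (be + ga), ga, 0, h.
by split=> //; [exact: Rg0|rewrite addrK|rewrite mul0r].
Qed.

Lemma RHg_D be x y : RHg be x -> RHg be y -> RHg be (x + y).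
Proof.
move=> [al [ga [a [h [ra rh h0 -> ->]]]]] [al' [ga' [a' [h' [ra' rh' h0' e ->]]]]].
exists (al + ga'), (ga + ga'), (a * h' + a' * h), (h * h'); split.
- apply: RgD; first exact: RgM.
  suff -> : al + ga' = al' + ga by exact: RgM.
  by rewrite -[al](subrK ga) e addrAC subrK.
- exact: RgM.
- by rewrite mulf_neq0.
- by rewrite opprD addrACA subrr addr0.
- by field; rewrite h0 h0'.
Qed.

Lemma RHg_M al be x y : RHg al x -> RHg be y -> RHg (al + be) (x * y).
Proof.
move=> [b [c [a [h [ra rh h0 -> ->]]]]] [b' [c' [a' [h' [ra' rh' h0' -> ->]]]]].
exists (b + b'), (c + c'), (a * a'), (h * h'); split; try exact: RgM.
- by rewrite mulf_neq0.
- by rewrite opprD addrACA.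
- by field; rewrite h0 h0'.
Qed.

Lemma Rg_RHg al x : Rg al x -> RHg al x.
Proof.
move=> rx; have [ga [h [rh h0]]] := exists_Hom.
exists (al + ga), ga, (x * h), h; split=> //; [exact: RgM|by rewrite addrK|].
by rewrite mulfK.
Qed.

Lemma RHg_N al x : RHg al x -> RHg al (- x).
Proof.
move=> [b [c [a [h [ra rh h0 -> ->]]]]]; exists b, c, (- a), h; split=> //.
  by rewrite -sub0r; apply: RgB => //; exact: Rg0.
by rewrite mulNr.
Qed.

Lemma RHg_1 : RHg 0 1.
Proof.
have [ga [h [rh h0]]] := exists_Hom; exists ga, ga, h, h.
by split=> //; [rewrite subrr|rewrite mulfV].
Qed.

Definition homog (s : seq (G * K)) : Prop := forall p, p \in s -> RHg p.1 p.2.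

Lemma homog_cons p s : homog (p :: s) <-> RHg p.1 p.2 /\ homog s.
Proof.
split=> [h|[hp h] q]; last by rewrite inE => /orP[/eqP ->|/h].
by split=> [|q qs]; apply: h; rewrite inE ?eqxx // qs orbT.
Qed.

Lemma homog_cat s t : homog s -> homog t -> homog (s ++ t).
Proof. by move=> hs ht p; rewrite mem_cat => /orP[/hs|/ht]. Qed.

Lemma homog_part s be : homog s -> RHg be (\sum_(p <- s | p.1 == be) p.2).
Proof.
move=> hs; rewrite big_seq_cond; apply: big_ind; [exact: RHg_0|by move=> *; exact: RHg_D|].
by move=> p /andP[/hs rp /eqP <-].
Qed.

(** Multiplication by [d] shifts all degrees by the same [ga], so statements about the grading of
    [R] carry over to [R_H]. *)
Lemma common_denominator s : homog s -> exists ga d,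
  [/\ Rg ga d, d != 0 & forall p, p \in s -> Rg (p.1 + ga) (d * p.2)].
Proof.
elim: s => [_|p s IH /homog_cons[hp /IH[ga [d [rd d0 hd]]]]].
  by have [ga [d [rd d0]]] := exists_Hom; exists ga, d; split.
case: hp => [al [ga' [a [h [ra rh h0 e1 e2]]]]].
exists (ga' + ga), (h * d); split; [exact: RgM|by rewrite mulf_neq0|].
move=> q; rewrite inE => /orP[/eqP ->|/hd rq].
  rewrite e1 e2 addrA subrK; have -> : h * d * (a / h) = a * d by field.
  exact: RgM.
by rewrite -mulrA addrCA; exact: RgM.
Qed.

Lemma homog_sum0 s be : homog s -> \sum_(p <- s) p.2 = 0 ->
  \sum_(p <- s | p.1 == be) p.2 = 0.
Proof.
move=> hs s0; have [bes|bes] := boolP (be \in map fst s); last first.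
  rewrite big1_seq // => p /andP[/eqP e ps]; case/negP: bes; rewrite -e.
  exact: map_f.
have [ga [d [rd d0 hd]]] := common_denominator hs.
pose g al := \sum_(p <- s | p.1 == al) p.2.
(* The directness axiom of the grading requires pairwise distinct degrees, so the terms are grouped
   by degree before the denominator is cleared. *)
pose s' := [seq (al + ga, d * g al) | al <- undup (map fst s)].
case: hR => _ _ _ _ /(_ s') h.
have : (d * g be) = 0.
  apply: (h _ _ _ (be + ga, d * g be)); last by apply: map_f; rewrite mem_undup.
  - rewrite -map_comp map_inj_uniq ?undup_uniq //; exact: addIr.
  - move=> _ /mapP[al _ ->] /=; rewrite /g mulr_sumr big_seq_cond.
    apply: big_ind; [exact: Rg0|by move=> *; exact: RgD|].
    by move=> p /andP[/hd rp /eqP <-].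
  - by rewrite big_map -mulr_sumr /g sum_group_by s0 mulr0.
by move/eqP; rewrite mulf_eq0 (negPf d0) => /eqP.
Qed.

(** An arbitrary choice; by [comp_sum] the components do not depend on it. *)
Definition decomposition (x : K) : seq (G * K) :=
  xget [::] [set s | homog s /\ x = \sum_(p <- s) p.2].

(* A junk value unless [x] is [decomposable]. *)
Definition comp (x : K) (be : G) : K := \sum_(p <- decomposition x | p.1 == be) p.2.

Definition decomposable (x : K) : Prop := exists2 s, homog s & x = \sum_(p <- s) p.2.

Lemma decompositionP x : decomposable x ->
  homog (decomposition x) /\ x = \sum_(p <- decomposition x) p.2.
Proof. by move=> [s hs e]; apply: (@xgetPex _ [::] [set s | homog s /\ x = _]); exists s. Qed.

Lemma comp_sum s be : homog s ->
  comp (\sum_(p <- s) p.2) be = \sum_(p <- s | p.1 == be) p.2.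
Proof.
move=> hs; have [|hD eD] := @decompositionP (\sum_(p <- s) p.2); first by exists s.
apply/subr0_eq; rewrite /comp.
(* The chosen decomposition followed by the negated list sums to zero, hence does so in every
   degree. *)
pose t := decomposition (\sum_(p <- s) p.2) ++ [seq (p.1, - p.2) | p <- s].
have ht : homog t.
  by apply: homog_cat => // _ /mapP[p /hs rp ->]; exact: RHg_N.
have := @homog_sum0 t be ht; rewrite !big_cat !big_map /= !sumrN.
by rewrite -eD subrr; exact.
Qed.

Lemma comp_homog x al be : RHg al x -> comp x be = if al == be then x else 0.
Proof.
move=> rx; have -> : x = \sum_(p <- [:: (al, x)]) p.2 by rewrite big_seq1.
rewrite comp_sum; first by rewrite big_seq1 big_mkcond big_seq1.
by move=> p; rewrite inE => /eqP ->.
Qed.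

Lemma hcomponentsP x y : decomposable x ->
  hcomponents Rg x y <-> exists be, y = comp x be.
Proof.
move=> [s hs ex]; split.
  move=> [t [ut ht et /mapP[p pt ->]]]; exists p.1; rewrite et comp_sum //.
  rewrite -big_filter; have -> : [seq q <- t | q.1 == p.1] = [:: p].
    rewrite -[t in LHS](@map_id _ t); elim: t p ut pt {ht et} => //= q t IH p /andP[qt ut].
    rewrite map_id inE => /orP[/eqP ->|pt].
      rewrite eqxx; congr (_ :: _); apply/eqP; rewrite -(negbK (_ == _)) -has_filter.
      apply/hasPn => r rt; apply: contra qt => /eqP <-; exact: map_f.
    rewrite ifN; first by have := IH p ut pt; rewrite map_id.
    by apply: contra qt => /eqP ->; exact: map_f.
  by rewrite big_seq1.
(* The extra zero term makes the degree [be] occur in the list even when the component there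
   vanishes. *)
move=> [be ->]; pose s' := (be, 0) :: s.
have hs' : homog s' by apply/homog_cons; split=> //; exact: RHg_0.
have ex' : x = \sum_(p <- s') p.2 by rewrite big_cons add0r.
exists [seq (k, comp x k) | k <- undup (map fst s')]; split.
- by rewrite -map_comp map_id undup_uniq.
- by move=> _ /mapP[k _ ->] /=; rewrite ex' comp_sum //; exact: homog_part.
- rewrite big_map /= [LHS]ex' -sum_group_by; apply: eq_bigr => k _.
  by rewrite ex' comp_sum.
- by apply/mapP; exists (be, comp x be) => //; apply: map_f; rewrite mem_undup mem_head.
Qed.

Definition decomposable_poly (f : {poly K}) : Prop := forall i, decomposable f`_i.

Lemma RH_decomposable x : RH R Rg x -> decomposable x.
Proof.
move=> [a [h [ra [h0 [ga rh]] ->]]].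
case: hR => _ _ _ /(_ a ra) [s [hs ->]] _.
exists [seq (p.1 - ga, p.2 / h) | p <- s].
  by move=> _ /mapP[p /hs rp ->] /=; exists p.1, ga, p.2, h.
by rewrite big_map mulr_suml.
Qed.

Lemma R_decomposable x : R x -> decomposable x.
Proof.
case: hR => _ _ _ h _ /h[s [hs ->]]; exists s => // p /hs; exact: Rg_RHg.
Qed.

Lemma comp_R x be : R x -> R (comp x be).
Proof.
case: hR => -[sR _] _ _ h _ /h[s [hs ->]]; rewrite comp_sum; last first.
  by move=> p /hs; exact: Rg_RHg.
by apply: (submod_sum (submod_self sR)) => p /hs /Rg_sub.
Qed.

Lemma comp_total x M : decomposable x -> submod R M -> (forall be, M (comp x be)) -> M x.
Proof.
move=> [s hs ->] sM h; rewrite -sum_group_by; apply: (submod_sum sM) => be _ _.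
by rewrite -comp_sum.
Qed.

(** * Contents, and polynomials as lists of homogeneous terms *)

Local Notation submod0 := (@submod0 K R).
Local Notation submodD := (@submodD K R).
Local Notation submodZ := (@submodZ K R).

Lemma Cont_submod x : submod R (Cont R Rg x).
Proof. exact: Rspan_submod graded_subring _. Qed.

Lemma Af_submod f : submod R (Af R Rg f).
Proof. by apply: (@big_msum_submod K R _ (fun i => Cont R Rg f`_i)) => i; exact: Cont_submod. Qed.

Lemma comp0 be : comp 0 be = 0.
Proof. by rewrite (@comp_homog 0 0 be); [case: ifP|exact: RHg_0]. Qed.

Lemma Af_comp f i be : decomposable_poly f -> Af R Rg f (comp f`_i be).
Proof.
move=> df; case: (ltnP i (size f)) => [li|]; last first.
  by move=> /(nth_default 0) ->; rewrite comp0; by apply: submod0; exact: Af_submod.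
apply: (@big_msum_sup K R _ (fun i => Cont R Rg f`_i) i) => // [j|]; first exact: Cont_submod.
by apply: (sub_Rspan graded_subring); apply/hcomponentsP => //; exists be.
Qed.

(** Together with [Af_comp], this characterizes [A_f] as the least submodule that contains all
    components of all coefficients. *)
Lemma Af_sub f M : decomposable_poly f -> submod R M ->
  (forall i be, M (comp f`_i be)) -> Af R Rg f `<=` M.
Proof.
move=> df sM h; rewrite /Af; apply: (big_ind (fun E => E `<=` M)).
- by move=> _ ->; exact: submod0.
- by move=> E F hE hF _ [e [g [/hE Me /hF Mg ->]]]; exact: submodD.
- move=> i _; apply: Rspan_sub => // y /(hcomponentsP _ (df i)).
  by move=> [be ->].
Qed.

(* A term [((n, be), c)] stands for the homogeneous element [c X^n] of degree
   [(n, be)], so that a list of terms decomposes an element of [R_H[X]]. *)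
Definition tpoly (s : seq ((nat * G) * K)) : {poly K} := \sum_(p <- s) p.2 *: 'X^(p.1.1).

Definition thomog (s : seq ((nat * G) * K)) : Prop :=
  forall p, p \in s -> RHg p.1.2 p.2.

Lemma thomog_cons p s : thomog (p :: s) <-> RHg p.1.2 p.2 /\ thomog s.
Proof.
split=> [h|[hp h] q]; last by rewrite inE => /orP[/eqP ->|/h].
by split=> [|q qs]; apply: h; rewrite inE ?eqxx // qs orbT.
Qed.

Lemma coef_tpoly s i :
  (tpoly s)`_i = \sum_(p <- [seq (p.1.2, p.2) | p <- s & p.1.1 == i]) p.2.
Proof.
rewrite /tpoly coef_sum big_map big_filter [RHS]big_mkcond; apply: eq_bigr => p _ /=.
by rewrite coefZ coefXn eq_sym; case: eqP; rewrite ?mulr1 ?mulr0.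
Qed.

Lemma thomog_coef s i : thomog s -> homog [seq (p.1.2, p.2) | p <- s & p.1.1 == i].
Proof. by move=> hs _ /mapP[p + ->]; rewrite mem_filter => /andP[_ /hs]. Qed.

Lemma tpoly_decomposable s : thomog s -> decomposable_poly (tpoly s).
Proof.
by move=> hs i; rewrite coef_tpoly; eexists; first exact: (thomog_coef hs).
Qed.

Lemma comp_tpoly s i be : thomog s ->
  comp (tpoly s)`_i be = \sum_(p <- s | p.1 == (i, be)) p.2.
Proof.
move=> hs; rewrite coef_tpoly comp_sum ?big_map ?big_filter_cond; last exact: thomog_coef.
by apply: eq_bigl => -[[j al] c].
Qed.

Definition tmul (p q : (nat * G) * K) : (nat * G) * K :=
  (((p.1.1 + q.1.1)%N, p.1.2 + q.1.2), p.2 * q.2).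

Definition smul s t := [seq tmul p q | p <- s, q <- t].

Lemma tpoly_smul s t : tpoly (smul s t) = tpoly s * tpoly t.
Proof.
rewrite /tpoly /smul big_allpairs_dep big_distrlr; apply: eq_bigr => p _.
by apply: eq_bigr => q _ /=; rewrite -scalerAl -scalerAr scalerA exprD.
Qed.

Lemma thomog_smul s t : thomog s -> thomog t -> thomog (smul s t).
Proof. by move=> hs ht _ /allpairsP[[p q] /= [/hs rp /ht rq ->]]; exact: RHg_M. Qed.

(** Adding the term [p] changes only the component in the degree of [p], and changes it by [p.2]. *)
Lemma Af_tpoly_cons p s : thomog (p :: s) ->
  Af R Rg (tpoly (p :: s)) `<=` msum (mscale p.2 R) (Af R Rg (tpoly s)).
Proof.
move=> hps; have [hp hs] := (thomog_cons p s).1 hps.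
apply: Af_sub; first exact: tpoly_decomposable.
  apply: msum_submod; last exact: Af_submod.
  by apply: mscale_submod; exact: submod_self graded_subring.
move=> i be; rewrite comp_tpoly // big_mkcond big_cons -big_mkcond -comp_tpoly //.
exists (if p.1 == (i, be) then p.2 else 0), (comp (tpoly s)`_i be).
split=> //; last exact/Af_comp/tpoly_decomposable.
case: ifP => _; first by exists 1; rewrite ?mulr1 //; exact: subring1 graded_subring.
by exists 0; rewrite ?mulr0 //; exact: subring0 graded_subring.
Qed.

(** With [f = p + f'], one has [f' g = f g - p g]; as [p] is a single term, each component of [p g]
    is zero or [p.2] times a component of [g]. *)
Lemma Af_tpoly_drop p s t : thomog (p :: s) -> thomog t ->
  Af R Rg (tpoly s * tpoly t) `<=`
  msum (Af R Rg (tpoly (p :: s) * tpoly t)) (mscale p.2 (Af R Rg (tpoly t))).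
Proof.
move=> hps ht; have [hp hs] := (thomog_cons p s).1 hps.
have sM : submod R (mscale p.2 (Af R Rg (tpoly t))) by exact/mscale_submod/Af_submod.
rewrite -!tpoly_smul; have hst := thomog_smul hs ht; have hpst := thomog_smul hps ht.
apply: Af_sub; first exact: tpoly_decomposable.
  by apply: msum_submod => //; exact: Af_submod.
move=> i be; exists (comp (tpoly (smul (p :: s) t))`_i be).
exists (- \sum_(q <- t | (tmul p q).1 == (i, be)) p.2 * q.2); split.
- exact/Af_comp/tpoly_decomposable.
- apply: (submodN graded_subring) => //; rewrite -mulr_sumr.
  (* Adding the degree of [p] is injective, so all terms [q] that land in [(i, be)] share the degree
     of [q0], and their sum is one component of [g]. *)
  have [/hasP[q0 q0t /eqP e]|/hasPn h] := boolP (has (fun q => (tmul p q).1 == (i, be)) t).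
    exists (\sum_(q <- t | q.1 == (q0.1.1, q0.1.2)) q.2).
      by rewrite -comp_tpoly //; exact/Af_comp/tpoly_decomposable.
    congr (_ * _); apply: eq_bigl => q; rewrite -e /= [in LHS]/eq_op [in RHS]/eq_op /=.
    by rewrite eqn_add2l (inj_eq (addrI _)).
  rewrite big1_seq ?mulr0; first exact: submod0.
  by move=> q /andP[hq /h]; rewrite hq.
- rewrite !comp_tpoly // [smul (p :: s) t]/= big_cat big_map /=.
  by rewrite addrAC subrr add0r.
Qed.

Lemma sum_uniq_key (T : eqType) (s : seq (T * K)) p : uniq (map fst s) -> p \in s ->
  \sum_(q <- s | q.1 == p.1) q.2 = p.2.
Proof.
elim: s => //= r s IH /andP[rs us]; rewrite inE big_cons => /orP[/eqP ->|ps].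
  rewrite eqxx big1_seq ?addr0 // => q /andP[/eqP e qs].
  by case/negP: rs; rewrite -e map_f.
by rewrite ifN ?IH //; apply: contra rs => /eqP ->; exact: map_f.
Qed.

Lemma Af_tpoly_term s p : thomog s -> uniq (map fst s) -> p \in s ->
  Af R Rg (tpoly s) p.2.
Proof.
move=> hs us ps; rewrite -(sum_uniq_key us ps); case: p.1 => i be.
by rewrite -comp_tpoly //; exact/Af_comp/tpoly_decomposable.
Qed.

(** As [key_ge] is reflexive, distinctness of the keys is what makes the order strict. *)
Definition descending (P : set G) (s : seq ((nat * G) * K)) : bool :=
  uniq (map fst s) && pairwise (fun p q : (nat * G) * K => `[< key_ge P p.1 q.1 >]) s.

Lemma descending_cons P p s : descending P (p :: s) ->
  [/\ p.1 \notin map fst s, (forall q, q \in s -> key_ge P p.1 q.1) & descending P s].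
Proof.
move=> /andP[/= /andP[h1 h2] /andP[/allP h3 h4]]; split=> //; last exact/andP.
by move=> q /h3 /asboolP.
Qed.

(** By [key_ge_add_eq], no other pair of terms reaches the degree of the product of the leading
    terms, so this product is a component of [f g]. *)
Lemma Af_leading P p s q t : cone P -> thomog (p :: s) -> thomog (q :: t) ->
  descending P (p :: s) -> descending P (q :: t) ->
  Af R Rg (tpoly (p :: s) * tpoly (q :: t)) (p.2 * q.2).
Proof.
move=> cP hs ht /descending_cons[ps gs ds] /descending_cons[qt gt dt].
have hst := thomog_smul hs ht; rewrite -tpoly_smul.
suff <- : comp (tpoly (smul (p :: s) (q :: t)))`_(p.1.1 + q.1.1) (p.1.2 + q.1.2)
    = p.2 * q.2 by exact/Af_comp/tpoly_decomposable.
rewrite comp_tpoly // big_mkcond big_allpairs_dep !big_cons /= eqxx.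
have key p' q' : p' \in p :: s -> q' \in q :: t ->
    (tmul p' q').1 = (tmul p q).1 -> p'.1 = p.1 /\ q'.1 = q.1.
  move=> hp' hq' [e1 e2]; apply: (key_ge_add_eq cP) => //.
    by move: hp'; rewrite inE => /orP[/eqP ->|/gs //]; exact: key_ge_refl.
  by move: hq'; rewrite inE => /orP[/eqP ->|/gt //]; exact: key_ge_refl.
rewrite big1_seq ?addr0; last first.
  move=> q' /= q't; case: eqP => // /key[||_ e]; [exact: mem_head|by rewrite inE q't orbT|].
  by case/negP: qt; rewrite -e map_f.
rewrite big1_seq ?addr0 // => p' /= p's; rewrite big1_seq // => q' /= q't.
case: eqP => // /key[|//|e _]; first by rewrite inE p's orbT.
by case/negP: ps; rewrite -e map_f.
Qed.

Lemma decomposable_tpoly f : decomposable_poly f -> exists2 s, thomog s & f = tpoly s.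
Proof.
move=> df; rewrite -[f]coefK poly_def; elim: (size f) => [|n [s hs es]].
  by exists [::] => //; rewrite big_ord0 /tpoly big_nil.
have [t ht et] := df n; exists ([seq ((n, p.1), p.2) | p <- t] ++ s).
  by move=> p; rewrite mem_cat => /orP[/mapP[q /ht rq ->]|/hs].
rewrite big_ord_recr /= es addrC /tpoly big_cat big_map /=; congr (_ + _).
by rewrite -scaler_suml -et.
Qed.

Lemma tpoly_uniq s : thomog s ->
  exists t, [/\ thomog t, uniq (map fst t), tpoly t = tpoly s &
                {subset map fst t <= map fst s}].
Proof.
move=> hs; pose g k := \sum_(p <- s | p.1 == k) p.2.
exists [seq (k, g k) | k <- undup (map fst s)]; split.
- move=> _ /mapP[[i be] _ ->] /=; rewrite /g big_seq_cond.
  apply: big_ind; [exact: RHg_0|by move=> *; exact: RHg_D|].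
  by move=> p /andP[/hs rp /eqP e]; move: rp; rewrite e.
- by rewrite -map_comp map_id undup_uniq.
- rewrite /tpoly big_map /= -[RHS]sum_group_by; apply: eq_bigr => k _.
  by rewrite /g scaler_suml; apply: eq_bigr => p /eqP ->.
- by rewrite -map_comp map_id => k; rewrite mem_undup.
Qed.

(** Sorting requires totality only among the degrees that occur, which is all that the cone
    provides. *)
Lemma tpoly_descending P s : cone P -> thomog s ->
  (forall k l, k \in map fst s -> l \in map fst s -> P (k.2 - l.2) \/ P (l.2 - k.2)) ->
  exists t, [/\ thomog t, descending P t & tpoly t = tpoly s].
Proof.
move=> cP /tpoly_uniq[t [ht ut <- sub]] tot.
pose ge (p q : (nat * G) * K) := `[< key_ge P p.1 q.1 >].
have get : {in t & &, transitive ge}.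
  move=> y x z _ _ _ /asboolP h1 /asboolP h2; apply/asboolP; exact: key_ge_trans h1 h2.
have geT : {in t &, total ge}.
  move=> x y xt yt; apply/orP.
  have := tot _ _ (sub _ (map_f fst xt)) (sub _ (map_f fst yt)).
  case: (ltngtP x.1.1 y.1.1) => e h.
  - by right; apply/asboolP; left.
  - by left; apply/asboolP; left.
  - by case: h => h; [left|right]; apply/asboolP; right.
have perm := permEl (perm_sort ge t); exists (sort ge t); split.
- by move=> p; rewrite mem_sort; exact: ht.
- rewrite /descending (perm_uniq (perm_map fst perm)) ut /=.
  have allt : all (mem t) t by exact/allP.
  by rewrite -(sorted_pairwise_in get) ?all_sort // (sort_sorted_in geT).
- exact: perm_big.
Qed.

(** * From invertibility to the content formula *)

Section Star.
Variable star : set K -> set K.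
Hypothesis hstar : semistar R star.

Local Notation w := (star_tilde R star).
Local Notation sR := graded_subring.

(** A homogeneous common denominator [d] turns the span [A] into a homogeneous ideal [I = d A]. If
    [y] is in [(R : I)] then [d y] is in [(R : A)], so [I (R : I)] lies in [A (R : A)]. *)
Lemma GPstarMD_invertible s : GPstarMD R Rg star -> homog s ->
  (exists2 a, Rspan R [set x | x \in map snd s] a & a != 0) ->
  w (mprod (Rspan R [set x | x \in map snd s])
           (colon R (Rspan R [set x | x \in map snd s]))) 1.
Proof.
set A := Rspan R _ => GP hs [a Aa a0].
have sA : submod R A by exact: Rspan_submod sR _.
have [ga [d [rd d0 hd]]] := common_denominator hs.
pose I := Rspan R [set x | x \in [seq d * p.2 | p <- s]].
have sI : submod R I by exact: Rspan_submod sR _.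
have gI x : x \in [seq d * p.2 | p <- s] -> R x /\ exists al, Rg al x.
  by move=> /mapP[p /hd rp ->]; split; [exact: Rg_sub rp|exists (p.1 + ga)].
have AI x : A x -> I (d * x).
  apply: (Rspan_sub (submod_scale d sI)) => _ /mapP[p ps ->] /=.
  by apply: (sub_Rspan sR) => /=; apply/mapP; exists p.
have IA : I `<=` mscale d A.
  apply: Rspan_sub; first exact: mscale_submod.
  move=> _ /mapP[p ps ->]; exists p.2 => //.
  by apply: (sub_Rspan sR) => /=; exact: map_f.
have IR : I `<=` R.
  by apply: Rspan_sub (submod_self sR) _ => x /gI[].
have nI : nzmod R I.
  by apply: (submod_nzmod sI (AI _ Aa)); rewrite mulf_neq0.
have hI : hom_ideal R Rg I.
  split=> //; apply/seteqP; split.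
    apply: Rspan_sub; first exact: Rspan_submod sR _.
    move=> x xs; apply: (sub_Rspan sR) => /=; split; last by case: (gI x xs).
    by apply: (sub_Rspan sR).
  by apply: Rspan_sub => // x [].
have := GP _ hI; rewrite (starf_invertibleP sR hstar sI) => inv.
apply: star_tilde_mono (inv _); last by eexists.
apply: (mprod_sub (mprod_submod _ sA)) => _ y /IA[x Ax <-] hy.
have -> : d * x * y = x * (d * y) by ring.
apply: mem_mprod => // z Az; have -> : d * y * z = y * (d * z) by ring.
exact/hy/AI.
Qed.

Lemma Af_tpoly_invertible s : GPstarMD R Rg star -> thomog s -> uniq (map fst s) ->
  (exists2 a, Af R Rg (tpoly s) a & a != 0) ->
  w (mprod (Af R Rg (tpoly s)) (colon R (Af R Rg (tpoly s)))) 1.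
Proof.
move=> GP hs us; pose s' := [seq (p.1.2, p.2) | p <- s].
suff -> : Af R Rg (tpoly s) = Rspan R [set x | x \in map snd s'].
  by apply: GPstarMD_invertible => // _ /mapP[p /hs rp ->].
rewrite -map_comp; apply/seteqP; split.
  have sS := Rspan_submod sR [set x | x \in [seq p.2 | p <- s]].
  apply: Af_sub => //; first exact: tpoly_decomposable.
  move=> i be; rewrite comp_tpoly //; apply: (submod_sum sS) => p ps _.
  by apply: (sub_Rspan sR); exact: map_f.
apply: Rspan_sub; first exact: Af_submod.
by move=> _ /mapP[p ps ->]; exact: Af_tpoly_term.
Qed.

Lemma content_formula P s t : cone P -> GPstarMD R Rg star ->
  thomog s -> thomog t -> descending P s -> descending P t ->
  forall a b, Af R Rg (tpoly s) a -> Af R Rg (tpoly t) b ->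
    w (Af R Rg (tpoly s * tpoly t)) (a * b).
Proof.
move=> cP GP.
have w0 f : w (Af R Rg f) 0.
  by apply: submod0; apply: (star_tilde_submod sR hstar); exact: Af_submod.
have Af0 a : Af R Rg (tpoly [::]) a -> a = 0.
  by rewrite /tpoly big_nil /Af size_poly0 big_ord0.
elim: s t => [|p s IHs] t; first by move=> _ _ _ _ a b /Af0 ->; rewrite mul0r.
elim: t => [|q t IHt]; first by move=> _ _ _ _ a b _ /Af0 ->; rewrite mulr0.
move=> hps hqt dps dqt.
have [hp hs] := (thomog_cons p s).1 hps; have [hq ht] := (thomog_cons q t).1 hqt.
have [_ _ ds] := descending_cons dps; have [_ _ dt] := descending_cons dqt.
set A := Af R Rg (tpoly (p :: s)); set B := Af R Rg (tpoly (q :: t)).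
set C := Af R Rg (tpoly (p :: s) * tpoly (q :: t)).
have sA : submod R A by exact: Af_submod.
have sB : submod R B by exact: Af_submod.
have sC : submod R C by exact: Af_submod.
have pqC : C (p.2 * q.2) by exact: (Af_leading cP).
have pA : A p.2 by apply: (@Af_tpoly_term (p :: s)); rewrite ?mem_head //; case/andP: dps.
have sCB : submod R (msum C (mscale p.2 B)) by exact/msum_submod/mscale_submod.
have sCA : submod R (msum C (mscale q.2 A)) by exact/msum_submod/mscale_submod.
(* Write [a = r p + a'] with [a'] in the content of the tail: [r p b] is in [p B], and the induction
   hypothesis handles [a' b] through [Af_tpoly_drop]. The claim [h2] is the same with the roles of
   the factors exchanged. *)
have h1 a b : A a -> B b -> w (msum C (mscale p.2 B)) (a * b).
  move=> Aa Bb; have [_ [a' [[r Rr <-] Aa' ->]]] := Af_tpoly_cons hps Aa.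
  rewrite mulrDl; apply: (submodD (star_tilde_submod sR hstar sCB)).
    apply: (star_tilde_ext sR) => //; exists 0, (p.2 * r * b); rewrite add0r.
    split=> //; first exact: submod0.
    by exists (r * b); [exact: submodZ|rewrite mulrA].
  apply: star_tilde_mono (IHs _ hs hqt ds dqt _ _ Aa' Bb).
  exact: Af_tpoly_drop.
have h2 a b : A a -> B b -> w (msum C (mscale q.2 A)) (a * b).
  move=> Aa Bb; have [_ [b' [[r Rr <-] Bb' ->]]] := Af_tpoly_cons hqt Bb.
  rewrite mulrDr; apply: (submodD (star_tilde_submod sR hstar sCA)).
    apply: (star_tilde_ext sR) => //; exists 0, (a * (q.2 * r)); rewrite add0r.
    split=> //; first exact: submod0.
    by exists (r * a); [exact: submodZ|ring].
  apply: star_tilde_mono (IHt hps ht dps dt _ _ Aa Bb').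
  by have := Af_tpoly_drop hqt hps; rewrite ![_ * tpoly (p :: s)]mulrC.
(* A nonzero [a] guarantees that [A] is nonzero, as invertibility requires. *)
move=> a b Aa Bb; have [->|a0] := eqVneq a 0; first by rewrite mul0r; exact: w0.
have inv : w (mprod A (colon R A)) 1.
  by apply: Af_tpoly_invertible => //; [case/andP: dps|exists a].
(* By [h1], [a b] may be replaced by [c + p b']. Here [a1 c] is in [A C]; by [h2], [a1 b'] may be
   replaced by [c' + q a'], and both [p c'] and [(p q) a'] are in [A C]. *)
apply: (star_tilde_cancel sR hstar sC inv) => a1 Aa1.
have sAC : submod R (mprod A C) by exact: mprod_submod.
apply: (star_tilde_scale sR hstar sAC _ (h1 _ _ Aa Bb)) => _ [c [_ [Cc [b' Bb' <-] ->]]].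
rewrite mulrDr; apply: (submodD (star_tilde_submod sR hstar sAC)).
  by apply: (star_tilde_ext sR) => //; exact: mem_mprod.
rewrite mulrCA; apply: (star_tilde_scale sR hstar sAC _ (h2 _ _ Aa1 Bb')).
move=> _ [c' [_ [Cc' [a' Aa' <-] ->]]]; apply: (star_tilde_ext sR) => //.
rewrite mulrDr; apply: submodD => //; first exact: mem_mprod.
by rewrite mulrA mulrC; exact: mem_mprod.
Qed.

Lemma Af_mul_sub f g : decomposable_poly f -> decomposable_poly g ->
  Af R Rg (f * g) `<=` mprod (Af R Rg f) (Af R Rg g).
Proof.
move=> /decomposable_tpoly[s0 /tpoly_uniq[s [hs us <- _]] ->].
move=> /decomposable_tpoly[t0 /tpoly_uniq[t [ht ut <- _]] ->].
have sM : submod R (mprod (Af R Rg (tpoly s)) (Af R Rg (tpoly t))).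
  exact/mprod_submod/Af_submod.
rewrite -tpoly_smul; have hst := thomog_smul hs ht.
apply: Af_sub => //; first exact: tpoly_decomposable.
move=> i be; rewrite comp_tpoly //; apply: (submod_sum sM).
move=> _ /allpairsP[[p q] /= [ps qt ->]] _.
by apply: mem_mprod; exact: Af_tpoly_term.
Qed.

(** * From the content formula to invertibility *)

Lemma RH_of_R x : R x -> RH R Rg x.
Proof.
move=> Rx; have [ga [h [rh h0]]] := exists_Hom; exists (x * h), h; split.
- by apply: (subringM sR) => //; exact: Rg_sub rh.
- by split=> //; exists ga.
- by rewrite mulfK.
Qed.

Lemma Af_constant_coef f x : decomposable_poly f -> f`_0 = x -> Af R Rg f x.
Proof.
move=> df <-; apply: comp_total (df 0%N) (Af_submod f) _ => be.
exact: Af_comp.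
Qed.

Hypothesis content_eq : forall f g : {poly K},
  (forall i, RH R Rg f`_i) -> (forall i, RH R Rg g`_i) ->
  w (mprod (Af R Rg f) (Af R Rg g)) = w (Af R Rg (f * g)).

(* The factorization [X^2 - j X + v (j - v) = (X - v) (X - (j - v))] replaces
   integral closedness. *)
Lemma quadratic_root_star_tilde v j : RH R Rg v -> RH R Rg (j - v) ->
  R j -> R (v * (j - v)) -> w R v.
Proof.
move=> hv hjv Rj Rvj.
have hN x : RH R Rg x -> RH R Rg (- x).
  move=> [a [h [ra hh ->]]]; exists (- a), h; split=> //; last by rewrite mulNr.
  exact: (subringN sR).
have coefXB x i : ('X - x%:P)`_i = if i == 0%N then - x else (i == 1%N)%:R.
  by rewrite coefB coefX coefC; case: i => [|i]; rewrite ?sub0r ?subr0.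
have RHb (b : bool) : RH R Rg b%:R.
  by apply: RH_of_R; case: b; [exact: (subring1 sR)|exact: (subring0 sR)].
have RHXB x i : RH R Rg x -> RH R Rg ('X - x%:P)`_i.
  by move=> hx; rewrite coefXB; case: ifP => _; [exact: hN|exact: RHb].
have dXB x : RH R Rg x -> decomposable_poly ('X - x%:P).
  by move=> hx i; apply/RH_decomposable/RHXB.
have Rprod i : R (('X - v%:P) * ('X - (j - v)%:P))`_i.
  have -> : ('X - v%:P) * ('X - (j - v)%:P) = 'X^2 - j%:P * 'X + (v * (j - v))%:P.
    by rewrite polyCM polyCB; ring.
  rewrite coefD coefB coefXn coefCM coefX coefC; apply: (subringD sR).
    apply: (subringB sR); last apply: (subringM sR) => //.
      by case: (i == _); [exact: (subring1 sR)|exact: (subring0 sR)].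
    by case: (i == _); [exact: (subring1 sR)|exact: (subring0 sR)].
  by case: ifP => _ //; exact: (subring0 sR).
suff : w (Af R Rg (('X - v%:P) * ('X - (j - v)%:P))) v.
  apply: star_tilde_mono; apply: Af_sub (submod_self sR) _ => i.
    exact: R_decomposable.
  by move=> be; exact: comp_R.
rewrite -content_eq; [|by move=> i; exact: RHXB|by move=> i; exact: RHXB].
apply: (star_tilde_ext sR); first exact/mprod_submod/Af_submod.
have Afv : Af R Rg ('X - v%:P) (- v).
  by apply: Af_constant_coef; [exact: (dXB _ hv)|rewrite coefXB].
suff /(mem_mprod (submodN sR (Af_submod _) Afv)) : Af R Rg ('X - (j - v)%:P) 1.
  by rewrite opprK mulr1.
have := @Af_comp ('X - (j - v)%:P) 1 0 (dXB _ hjv).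
by rewrite coefXB /= (comp_homog _ RHg_1) eqxx.
Qed.

(** The mixed terms of [(a + b X) (a - b X)] cancel, so its content lies in [(a^2, b^2)], whereas
    [a b] lies in the product of the contents of the factors. *)
Lemma square_relation al be a b : Rg al a -> Rg be b ->
  w (msum (mscale (a ^+ 2) R) (mscale (b ^+ 2) R)) (a * b).
Proof.
move=> ra rb; have Ra := Rg_sub ra; have Rb := Rg_sub rb.
pose f x : {poly K} := a%:P + x%:P * 'X.
have coef_f x i : (f x)`_i = if i == 0%N then a else if i == 1%N then x else 0.
  rewrite coefD coefC coefCM coefX; case: i => [|[|i]] /=;
  by rewrite ?mulr0 ?mulr1 ?addr0 ?add0r.
have Rf x i : R x -> R (f x)`_i.
  move=> Rx; rewrite coef_f; case: ifP => // _; case: ifP => // _.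
  exact: (subring0 sR).
have RNb : R (- b) by exact: (subringN sR).
have df x : R x -> decomposable_poly (f x).
  by move=> Rx i; apply/R_decomposable/Rf.
set Q := msum _ _.
have sQ : submod R Q.
  by apply: msum_submod; apply: mscale_submod; exact: (submod_self sR).
have Qa : Q (a * a).
  exists (a * a), 0; rewrite addr0; split=> //.
    by exists 1; [exact: (subring1 sR)|rewrite mulr1].
  by exists 0; [exact: (subring0 sR)|rewrite mulr0].
have Qb : Q (- (b * b)).
  apply: (submodN sR sQ); exists 0, (b * b); rewrite add0r; split=> //.
    by exists 0; [exact: (subring0 sR)|rewrite mulr0].
  by exists 1; [exact: (subring1 sR)|rewrite mulr1].
have sub : Af R Rg (f b * f (- b)) `<=` Q.
  have e : f b * f (- b) = (a * a)%:P - (b * b)%:P * 'X^2.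
    by rewrite /f !polyCM polyCN; ring.
  have ce i : (f b * f (- b))`_i =
      if i == 0%N then a * a else if i == 2 then - (b * b) else 0.
    rewrite e coefB coefC coefCM coefXn; case: i => [|[|[|i]]] /=;
    by rewrite ?mulr0 ?mulr1 ?subr0 ?sub0r.
  have Rce i : R (f b * f (- b))`_i.
    rewrite ce; case: ifP => _; first exact: (subringM sR).
    by case: ifP => _; [exact/(subringN sR)/(subringM sR)|exact: (subring0 sR)].
  apply: (Af_sub _ sQ); first by move=> i; exact/R_decomposable/Rce.
  move=> i ga; rewrite ce; case: ifP => _.
    have haa : RHg (al + al) (a * a) by exact/Rg_RHg/RgM.
    by rewrite (comp_homog _ haa); case: ifP => _ //; exact: (submod0 sQ).
  case: ifP => _; last by rewrite comp0; exact: (submod0 sQ).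
  have hbb : RHg (be + be) (- (b * b)) by exact/RHg_N/Rg_RHg/RgM.
  by rewrite (comp_homog _ hbb); case: ifP => _ //; exact: (submod0 sQ).
apply: (star_tilde_mono sub); rewrite -content_eq; first last.
- by move=> i; exact/RH_of_R/Rf.
- by move=> i; exact/RH_of_R/Rf.
apply: (star_tilde_ext sR); first exact/mprod_submod/Af_submod.
apply: mem_mprod; first by apply: Af_constant_coef; [exact: df|rewrite coef_f].
have := submodN sR (Af_submod _) (@Af_comp (f (- b)) 1 be (df _ RNb)).
by rewrite coef_f /= (comp_homog _ (RHg_N (Rg_RHg rb))) eqxx opprK.
Qed.

Lemma pair_invertible al be a b (I := Rspan R [set x | x \in [:: a; b]]) :
  Rg al a -> Rg be b -> a != 0 -> b != 0 -> w (mprod I (colon R I)) 1.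
Proof.
move=> ra rb a0 b0; have Ra := Rg_sub ra; have Rb := Rg_sub rb.
have sI : submod R I by exact: (Rspan_submod sR).
have Ia : I a by apply: (sub_Rspan sR); rewrite /= mem_head.
have Ib : I b by apply: (sub_Rspan sR); rewrite /= !inE eqxx orbT.
set T := mprod I _; have sT : submod R T by exact: mprod_submod.
have colonI y : R (y * a) -> R (y * b) -> colon R I y.
  move=> ya yb; apply: (Rspan_sub (submod_scale y (submod_self sR))) => x /=.
  by rewrite !inE => /orP[/eqP ->|/eqP ->].
(* Two ideals of the system are used in turn: [J] from the relation between squares, then [J']
   carrying [v] into [R]. *)
apply: (star_tilde_idem sR hstar sT).
have [J dJ hJ] := (star_tildeP _ _ _ _).1 (square_relation ra rb).
apply/star_tildeP; exists J => // j Jj; rewrite mul1r.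
have Rj : R j by case: dJ => h _ _ _; exact: h.
have [_ [_ [[r Rr <-] [s Rs <-] e]]] := hJ j Jj.
(* Division of [a b j = r a^2 + s b^2] by [a b] gives [j = v + r a / b]. The product of the two
   summands is [r s], in [R], so [v] is a root of [X^2 - j X + r s]. *)
pose v := s * b / a.
have ejv : j - v = r * a / b.
  apply: (mulfI (mulf_neq0 a0 b0)).
  have -> : a * b * (j - v) = a * b * j - b ^+ 2 * s by rewrite /v; field.
  by rewrite e; field.
have wv : w R v.
  apply: (@quadratic_root_star_tilde v j) => //.
  - exists (s * b), a; split=> //; first exact: (subringM sR).
    by split=> //; exists al.
  - rewrite ejv; exists (r * a), b; split=> //; first exact: (subringM sR).
    by split=> //; exists be.
  - rewrite ejv; have -> : v * (r * a / b) = s * r by rewrite /v; field; rewrite ?a0 ?b0.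
    exact: (subringM sR).
have [J' dJ' hJ'] := (star_tildeP _ _ _ _).1 wv.
apply/star_tildeP; exists J' => // d J'd.
have Rd : R d by case: dJ' => h _ _ _; exact: h.
have Rvd := hJ' _ J'd.
(* Since [v d] is in [R], the fractions [d r / b] and [d s / a] both carry [a] and [b] into [R]. *)
have -> : j * d = a * (d * r / b) + b * (d * s / a).
  have -> : j = v + r * a / b by rewrite -ejv; ring.
  by rewrite /v; field; rewrite ?a0 ?b0.
apply: (submodD sT); apply: mem_mprod => //; apply: colonI.
- have -> : d * r / b * a = d * j - v * d.
    by have -> : j = v + r * a / b by [rewrite -ejv; ring]; field.
  by apply: (subringB sR) => //; exact: (subringM sR).
- by have -> : d * r / b * b = d * r by [field]; exact: (subringM sR).
- by have -> : d * s / a * a = d * s by [field]; exact: (subringM sR).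
- by have -> : d * s / a * b = v * d by [rewrite /v; field].
Qed.

(* If [e = a y] with [y] in [(R : I)] and [j = a p + b q] with [p, q] in
   [(R : (a, b))], then [e j = a (y a p) + b (y a q)], and [y a p], [y a q] are in
   [(R : I + (b))]. *)
Lemma homog_invertible (l : seq K) (I := Rspan R [set x | x \in l]) : l != [::] ->
  (forall x, x \in l -> x != 0 /\ exists al, Rg al x) ->
  w (mprod I (colon R I)) 1.
Proof.
rewrite {}/I; elim: l => // b l IH _ hl.
have [b0 [be rb]] := hl b (mem_head _ _).
have {}hl x : x \in l -> x != 0 /\ exists al, Rg al x.
  by move=> xl; apply: hl; rewrite inE xl orbT.
set I' := Rspan R _.
have sI' : submod R I' by exact: (Rspan_submod sR).
set T' := mprod I' _; have sT' : submod R T' by exact: mprod_submod.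
have I'b : I' b by apply: (sub_Rspan sR); rewrite /= mem_head.
have I'l x : x \in l -> I' x.
  by move=> xl; apply: (sub_Rspan sR); rewrite /= inE xl orbT.
have colonI' y : R (y * b) -> (forall x, x \in l -> R (y * x)) -> colon R I' y.
  move=> yb yl; apply: (Rspan_sub (submod_scale y (submod_self sR))) => x /=.
  by rewrite inE => /orP[/eqP ->|/yl].
have [l0|ln] := eqVneq l [::].
  apply: (star_tilde_ext sR) => //; rewrite -(mulfV b0); apply: mem_mprod => //.
  by apply: colonI'; rewrite ?l0 // mulVf //; exact: (subring1 sR).
apply: (star_tilde_idem sR hstar sT'); apply: star_tilde_mono (IH ln hl).
have swT' := star_tilde_submod sR hstar sT'.
apply: (mprod_sub swT') => e y + hy; move: e.
suff h a : a \in l -> w T' (y * a).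
  by move=> e Ie; rewrite mulrC; apply: (Rspan_sub (submod_scale y swT')) Ie.
move=> al; have [a0 [alp ra]] := hl a al.
rewrite -[y * a]mulr1.
apply: (star_tilde_scale sR hstar sT' _ (pair_invertible ra rb a0 b0)).
apply: (mprod_sub (submod_scale (y * a) swT')) => c p Ic hp /=.
apply: (star_tilde_ext sR) => //; have -> : y * a * (c * p) = c * (y * a * p) by ring.
have sub x : x \in [:: a; b] -> Rspan R [set x | x \in [:: a; b]] x.
  by move=> xab; exact: (sub_Rspan sR).
have Rpa : R (p * a) by apply/hp/sub; rewrite mem_head.
have Rpb : R (p * b) by apply/hp/sub; rewrite !inE eqxx orbT.
have Ryl x : x \in l -> R (y * x) by move=> xl; apply/hy/(sub_Rspan sR).
apply: mem_mprod.
  by apply: (Rspan_sub sI' _ Ic) => x /=; rewrite !inE => /orP[/eqP ->|/eqP ->] //; exact: I'l.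
apply: colonI' => [|x xl].
  have -> : y * a * p * b = (y * a) * (p * b) by ring.
  by apply: (subringM sR) => //; exact: Ryl.
have -> : y * a * p * x = (y * x) * (p * a) by ring.
by apply: (subringM sR) => //; exact: Ryl.
Qed.

Lemma content_eq_GPstarMD : GPstarMD R Rg star.
Proof.
move=> I [IR nI eI] [s es].
have sI := nzmod_submod nI; apply/(starf_invertibleP sR hstar sI).
set S := [set x | I x /\ _] in eI.
(* The given generators of [I] need not be homogeneous. Each is a finite combination of homogeneous
   elements of [I], and the nonzero ones among these form [l]. *)
have [l hl hs] : exists2 l : seq K, (forall x, x \in l -> S x /\ x != 0) &
    forall x, x \in s -> Rspan R [set y | y \in l] x.
  have : forall x, x \in s -> Rspan R S x.
    by move=> x xs; rewrite -eI es; exact: (sub_Rspan sR).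
  elim: s {es} => [_|x s IH h]; first by exists [::].
  have [|l hl hs] := IH; first by move=> z zs; apply: h; rewrite inE zs orbT.
  have [t [ht ->]] := h x (mem_head _ _).
  exists ([seq p.2 | p <- t & p.2 != 0] ++ l).
    move=> y; rewrite mem_cat => /orP[/mapP[p + ->]|/hl //].
    by rewrite mem_filter => /andP[p0 /ht[]].
  set l' := _ ++ l.
  have sl' : submod R (Rspan R [set y | y \in l']) by exact: (Rspan_submod sR).
  move=> z; rewrite inE => /orP[/eqP ->|/hs].
    apply: (submod_sum sl') => p pt _; have [->|p0] := eqVneq p.2 0.
      by rewrite mulr0; exact: (submod0 sl').
    apply: (submodZ sl'); first by case: (ht p pt).
    apply: (sub_Rspan sR); rewrite /= mem_cat; apply/orP; left.
    by apply: map_f; rewrite mem_filter p0.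
  apply: (Rspan_sub sl') => y yl; apply: (sub_Rspan sR).
  by rewrite /= mem_cat yl orbT.
have -> : I = Rspan R [set x | x \in l].
  apply/seteqP; split; first by rewrite es; apply: Rspan_sub; first exact: (Rspan_submod sR).
  by apply: (Rspan_sub sI) => x /hl[[]].
apply: homog_invertible; last by move=> x /hl[[_ hx] x0].
(* If [l] were empty, all generators of [I], and hence [I], would vanish. *)
case: (l) hs => // hs; case: nI => _ _ _ [x [Ix /negP[]]].
have s0 : submod R [set 0 : K].
  by split=> //= [a b -> ->|r a _ ->]; rewrite ?addr0 ?mulr0.
have h0 : Rspan R [set y | y \in [::]] `<=` [set 0 : K] by exact: Rspan_sub.
move: Ix; rewrite es => Ix; apply/eqP.
by apply: (Rspan_sub s0 _ Ix) => y /hs /h0.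
Qed.

End Star.

End Components.

Theorem theorem3p2 (G : zmodType) (Gam : set G) (K : fieldType) (R : set K)
    (Rg : G -> set K) (star : set K -> set K)
    (hGam : grading_monoid Gam) (hR : graded_domain Gam R Rg)
    (hstar : semistar R star)
    (hproper : star R `<=` RH R Rg /\ star R <> RH R Rg) :
  GPstarMD R Rg star <->
  (forall f g : {poly K}, (forall i, RH R Rg f`_i) -> (forall i, RH R Rg g`_i) ->
     star_tilde R star (mprod (Af R Rg f) (Af R Rg g)) =
     star_tilde R star (Af R Rg (f * g))).
Proof.
have sR := graded_subring hR.
split=> [GP f g hf hg|]; last exact: (content_eq_GPstarMD hR hstar).
have df : decomposable_poly Rg f by move=> i; apply: (RH_decomposable hR).
have dg : decomposable_poly Rg g by move=> i; apply: (RH_decomposable hR).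
apply/seteqP; split; last exact/star_tilde_mono/(Af_mul_sub hR).
have sAf h := Af_submod hR h.
case: hGam => _ _ _ tfG.
have [s hs es] := decomposable_tpoly df; have [t ht et] := decomposable_tpoly dg.
(* A single cone has to order the terms of [f] and of [g], so it is made to decide all differences
   of degrees from both lists. *)
pose degrees := [seq k.2 | k <- map fst (s ++ t)].
have [P cP tot] := cone_total_on tfG [seq x - y | x <- degrees, y <- degrees].
have tot' k l : k \in map fst (s ++ t) -> l \in map fst (s ++ t) ->
    P (k.2 - l.2) \/ P (l.2 - k.2).
  move=> hk hl; rewrite -[l.2 - k.2]opprB; apply: tot.
  by apply/allpairsP; exists (k.2, l.2); split=> //; exact: map_f.
have [k l|s' [hs' ds' es']] := tpoly_descending hR cP hs.
  by move=> hk hl; apply: tot'; rewrite map_cat mem_cat ?hk ?hl.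
have [k l|t' [ht' dt' et']] := tpoly_descending hR cP ht.
  by move=> hk hl; apply: tot'; rewrite map_cat mem_cat ?hk ?hl orbT.
move=> x hx; apply: (star_tilde_idem sR hstar (sAf _)).
apply: star_tilde_mono hx; apply: mprod_sub.
  exact: (star_tilde_submod sR hstar (sAf _)).
by move=> a b; rewrite es et -es' -et'; exact: (content_formula hR hstar cP GP).
Qed.
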